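(* There is a nondeterministic oblivious read-once branching program of size $O(n^4)$ that computes the median on $n$ integers from $[2n]$.
   Context: $[N]=\{1,\dots,N\}$. For $n$ input integers (not necessarily distinct), the median is the middle element in sorted order (the $n/2$-th largest when $n$ is even). A (deterministic) branching program on $n$ inputs from a finite set $D$ (here $D=[2n]$) is a connected directed acyclic multigraph with a source node and possibly many sink nodes; each non-sink node is labeled by an input index in $[n]$, each edge by an element of $D$ (the value of the input indexed at its originating node), with exactly one out-edge of each non-sink node for each element of $D$; each sink is labeled by an output value. A nondeterministic branching program for a (non-Boolean) function is defined in the same way except that multiple out-edges of a node may have the same label and out-edges for some labels may not be present; every input must have at least one consistent path from the source that leads to a sink, and all paths followed by a given input that lead to a sink must lead to the same one, whose label is the output value. The size is the number of nodes. The program is oblivious if on every path from the source to a sink the sequence of input indices is precisely the same, and read-once if no input index appears more than once on any path from the source to a sink. *)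

(* Defs.v *)
From mathcomp Require Import all_boot.

Set Implicit Arguments.
Unset Strict Implicit.
Unset Printing Implicit Defensive.

(* The set {1, ..., N}. *)
Definition upto (N : nat) : finType := {k : 'I_N.+1 | 0 < k}.

Definition upto_nat (N : nat) (k : upto N) : nat := val (val k).

(* The median is the ceil(n/2)-th largest of the n values, with multiplicity:
   the middle one for n odd, the (n/2)-th largest one for n even. *)
Definition median (n : nat) (a : 'I_n -> nat) : nat :=
  nth 0 (sort geq [seq a i | i : 'I_n]) (uphalf n).-1.

(* The labelled graph underlying a nondeterministic branching program on n
   inputs from D with output values in O.  A node labelled [inl i] queries
   input i, a node labelled [inr o] outputs o.  Edges form a type of their own,
   so that parallel edges, equally labelled or not, are allowed; nothing is
   required of the labels of the edges leaving a node. *)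
Record bprog (n : nat) (D : finType) (O : Type) := BProg {
  node : finType;
  edge : finType;
  esrc : edge -> node;
  etgt : edge -> node;
  elabel : edge -> D;
  nlabel : node -> 'I_n + O;
  source : node;
  sourceP : forall v, (v == source) = ~~ [exists e, etgt e == v];
  sinkP : forall v, (if nlabel v is inr _ then true else false)
                    = ~~ [exists e, esrc e == v];
  bp_connected : forall u v,
    connect (fun a b => [exists e, ((esrc e == a) && (etgt e == b))
                                || ((esrc e == b) && (etgt e == a))]) u v;
  bp_acyclic : forall e p,
    path (fun e1 e2 => etgt e1 == esrc e2) e p ->
    etgt (last e p) != esrc e }.

Section BranchingPrograms.
Variables (n : nat) (D : finType) (O : Type) (B : bprog n D O).

Definition bp_size : nat := #|node B|.

Definition is_sink (v : node B) : bool := ~~ [exists e, esrc e == v].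

Fixpoint walk (u : node B) (p : seq (edge B)) (v : node B) : bool :=
  if p is e :: p' then (esrc e == u) && walk (etgt e) p' v else u == v.

Definition query (v : node B) : option 'I_n :=
  if nlabel v is inl i then Some i else None.

(* By [sinkP] the source node of an edge always queries an input, so [pmap]
   drops no edge. *)
Definition queries (p : seq (edge B)) : seq 'I_n :=
  pmap (fun e => query (esrc e)) p.

Definition consistent (x : 'I_n -> D) (p : seq (edge B)) : bool :=
  all (fun e => if query (esrc e) is Some i then elabel e == x i else false) p.

Definition leads_to (x : 'I_n -> D) (t : node B) : Prop :=
  is_sink t /\ exists p, walk (source B) p t && consistent x p.

(* All paths of an input to a sink must end in the same node, not merely in
   nodes with the same output. *)
Definition nondet_bp : Prop :=
  forall x, exists t, leads_to x t /\ forall t', leads_to x t' -> t' = t.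

Definition computes (f : ('I_n -> D) -> O) : Prop :=
  forall x t, leads_to x t -> nlabel t = inr (f x).

Definition oblivious : Prop :=
  forall p q s t, is_sink s -> is_sink t ->
    walk (source B) p s -> walk (source B) q t -> queries p = queries q.

Definition read_once : Prop :=
  forall p t, is_sink t -> walk (source B) p t -> uniq (queries p).

End BranchingPrograms.

(* Main.v *)
(* With k = ceil(n/2), m is the k-th largest of the n inputs iff it is positive,
   at most n - k inputs are below m and fewer than k are above m.  The program
   guesses m while reading the first input and then reads the inputs in order,
   counting those below and above m, and has no edge when a count would exceed
   its bound.  Since an input equal to m changes neither count, no node that can
   be reached is a dead end.  After the last input the counts are discarded, so
   that the sink reached is determined by m. *)

Require Import Defs.
From mathcomp Require Import all_boot zify.

Set Implicit Arguments.
Unset Strict Implicit.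
Unset Printing Implicit Defensive.

Lemma walk_rcons n (D : finType) O (B : bprog n D O) (u v w : node B) p e :
  walk u p v -> esrc e = v -> etgt e = w -> walk u (rcons p e) w.
Proof.
move=> + ev ew; elim: p u => [|f p IH] u /=; last by case/andP=> -> /IH.
by rewrite ev ew eq_sym eqxx andbT.
Qed.

(** * Branching programs from layered transition systems *)

Section LayeredProgram.

Variables (n : nat) (D : finType) (O : Type) (T : finType).
Variables (layer : T -> nat) (step : T -> D -> T -> bool).
Variables (out : T -> O) (s : T).

Definition move (v w : T) : bool := [exists d, step v d w].

Hypothesis layer_s : layer s = 0.
Hypothesis step_layer : forall v d w,
  step v d w -> layer v < n /\ layer w = (layer v).+1.
Hypothesis progress : forall v,
  connect move s v -> layer v < n -> exists d w, step v d w.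

(* Restricting to reachable states leaves [s] as the only node without an
   incoming edge. *)
Definition lnode : finType := {v : T | connect move s v}.
Definition ledge : finType :=
  {e : T * D * T | connect move s e.1.1 && step e.1.1 e.1.2 e.2}.

Lemma ledge_src (e : ledge) : connect move s (val e).1.1.
Proof. by case/andP: (valP e). Qed.

Lemma ledge_step (e : ledge) : step (val e).1.1 (val e).1.2 (val e).2.
Proof. by case/andP: (valP e). Qed.

Lemma ledge_tgt (e : ledge) : connect move s (val e).2.
Proof.
apply: connect_trans (ledge_src e) (connect1 _).
by apply/existsP; exists (val e).1.2; apply: ledge_step.
Qed.

Definition lsrc (e : ledge) : lnode := Sub (val e).1.1 (ledge_src e).
Definition ltgt (e : ledge) : lnode := Sub (val e).2 (ledge_tgt e).
Definition llabel (e : ledge) : D := (val e).1.2.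
Definition lsource : lnode := Sub s (connect0 move s).
(** [insub] succeeds exactly below layer [n], so the layer is itself the index of the queried input.
    Obliviousness and read-once both come from this. *)
Definition lnlabel (v : lnode) : 'I_n + O :=
  if insub (layer (val v)) is Some i then inl i else inr (out (val v)).

Lemma ledge_exists (v w : lnode) d :
  step (val v) d (val w) -> exists2 e, lsrc e = v /\ ltgt e = w & llabel e = d.
Proof.
move=> vw; have P : connect move s (val v) && step (val v) d (val w).
  by rewrite (valP v).
by exists (Sub (val v, d, val w) P) => //; split; apply: val_inj.
Qed.

Lemma lnode_step (v : lnode) d w :
  step (val v) d w -> exists w' : lnode, val w' = w.
Proof.
move=> vw; suff sw : connect move s w by exists (Sub w sw).
by apply: connect_trans (valP v) (connect1 _); apply/existsP; exists d.
Qed.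

Lemma ledge_layer (e : ledge) :
  layer (val (lsrc e)) < n /\
  layer (val (ltgt e)) = (layer (val (lsrc e))).+1.
Proof. exact: step_layer (ledge_step e). Qed.

Lemma connect_last v : connect move s v -> v = s \/ exists u,
  connect move s u /\ move u v.
Proof.
case/connectP=> p; case/lastP: p => [_ ->|p w]; first by left.
rewrite rcons_path last_rcons => /andP[sp mw] ->; right.
by exists (last s p); split=> //; apply/connectP; exists p.
Qed.

(** Edge targets have positive layer, hence differ from the source; any other node, being reachable,
    is entered by the last edge of a path from [s]. *)
Lemma lsourceP v : (v == lsource) = ~~ [exists e, ltgt e == v].
Proof.
apply/eqP/existsPn => [-> e|no_in].
  apply/eqP => /(congr1 (fun v => layer (val v))).
  by rewrite (ledge_layer e).2 /= layer_s.
apply: val_inj; case: (connect_last (valP v)) => // -[u [su /existsP[d ud]]].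
have [e [_ ev] _] := @ledge_exists (Sub u su) v d ud.
by move: (no_in e); rewrite ev eqxx.
Qed.

(** [progress] gives each reachable state below layer [n] an out-edge, and [step_layer] allows none
    from layer [n] on. *)
Lemma lsink_layer v : ~~ [exists e, lsrc e == v] = (n <= layer (val v)).
Proof.
apply/existsPn/idP => [no_out|nv e].
  rewrite leqNgt; apply/negP => /(progress (valP v))[d [w vw]].
  have [w' w'E] := lnode_step vw; rewrite -w'E in vw.
  have [e [ev _] _] := ledge_exists vw.
  by move: (no_out e); rewrite ev eqxx.
by apply/eqP => ev; have [] := ledge_layer e; rewrite ev ltnNge nv.
Qed.

Lemma lsinkP v : (if lnlabel v is inr _ then true else false)
  = ~~ [exists e, lsrc e == v].
Proof.
rewrite lsink_layer /lnlabel; case: insubP => [i iv _|].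
  by rewrite leqNgt iv.
by rewrite -leqNgt => ->.
Qed.

(** The relation is symmetric, so it suffices to link each node to the source, by induction on its
    layer through a predecessor. *)
Lemma lconnected u v :
  connect (fun a b => [exists e, ((lsrc e == a) && (ltgt e == b))
                              || ((lsrc e == b) && (ltgt e == a))]) u v.
Proof.
set r := (fun a b => _).
have r_sym : connect_sym r.
  by apply: sym_connect_sym => a b; apply: eq_existsb => e; rewrite orbC.
suff sv w : connect r lsource w.
  by apply: connect_trans (sv v); rewrite r_sym.
have [k] := ubnP (layer (val w)); elim: k w => // k IH w ltk.
case: (connect_last (valP w)) => [ws | [x [sx /existsP[d xw]]]].
  by rewrite (_ : w = lsource) //; apply: val_inj.
have [e [ex ew] _] := @ledge_exists (Sub x sx) w d xw.
apply: (@connect_trans _ _ (Sub x sx)).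
  apply: IH; rewrite SubK; have [_] := step_layer xw; lia.
by apply/connect1/existsP; exists e; rewrite ex ew !eqxx.
Qed.

(** Layers strictly increase along a path, so it cannot close up. *)
Lemma lacyclic e p : path (fun e1 e2 => ltgt e1 == lsrc e2) e p ->
  ltgt (last e p) != lsrc e.
Proof.
suff lt f : path (fun e1 e2 => ltgt e1 == lsrc e2) f p ->
    layer (val (lsrc f)) < layer (val (ltgt (last f p))).
  by move/lt; apply: contraTneq => ->; rewrite ltnn.
elim: p f => [|g p IH] f /=; first by rewrite (ledge_layer f).2.
case/andP=> /eqP fg /IH; apply: ltn_trans.
by rewrite -fg (ledge_layer f).2.
Qed.

Definition layered_bprog : bprog n D O :=
  BProg llabel lsourceP lsinkP lconnected lacyclic.

Lemma lnlabel_layer (v : lnode) :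
  omap val (query (v : node layered_bprog)) =
  if layer (val v) < n then Some (layer (val v)) else None.
Proof.
rewrite /query /= /lnlabel; case: insubP => [i _ <-|/negPf-> //].
by rewrite /= ltn_ord.
Qed.

Lemma walk_layer u p v : @walk _ _ _ layered_bprog u p v ->
  layer (val v) = layer (val u) + size p /\
  map val (queries p) = iota (layer (val u)) (size p).
Proof.
elim: p u => [|e p IH] u /=; first by move/eqP->; rewrite addn0.
case/andP=> /eqP eu /IH[-> qp]; have [lt_n tE] := ledge_layer e.
rewrite eu in lt_n tE; rewrite /= tE addSnnS; split=> //.
move: (lnlabel_layer u); rewrite lt_n /queries /= eu.
by case: query => //= i [->]; rewrite -/(queries _) qp tE.
Qed.

Lemma layered_layer_le (v : lnode) : layer (val v) <= n.
Proof.
case: (connect_last (valP v)) => [->|[u [_ /existsP[d uv]]]].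
  by rewrite layer_s.
by have [lt_n ->] := step_layer uv.
Qed.

Lemma is_sink_layer (t : node layered_bprog) :
  is_sink t = (layer (val t) == n).
Proof.
by rewrite /is_sink (lsink_layer t) eqn_leq layered_layer_le.
Qed.

Lemma walk_to_sink p t : is_sink t ->
  walk (source layered_bprog) p t -> map val (queries p) = iota 0 n.
Proof.
rewrite is_sink_layer => /eqP tn /walk_layer[]; rewrite /= layer_s tn.
by move=> nE ->; rewrite -[size p]add0n -nE.
Qed.

Lemma layered_oblivious : oblivious layered_bprog.
Proof.
move=> p q t t' st st' /(walk_to_sink st) pE /(walk_to_sink st') qE.
by apply: (inj_map val_inj); rewrite pE qE.
Qed.

Lemma layered_read_once : read_once layered_bprog.
Proof.
move=> p t st /(walk_to_sink st) pE.
by rewrite -(map_inj_uniq val_inj) pE iota_uniq.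
Qed.

Lemma layered_size : bp_size layered_bprog <= #|T|.
Proof. by rewrite /bp_size /= card_sig max_card. Qed.

Lemma layered_sink_label (t : node layered_bprog) :
  is_sink t -> nlabel t = inr (out (val t)).
Proof.
rewrite is_sink_layer => /eqP tn; rewrite /= /lnlabel.
by case: insubP => // i; rewrite tn ltnn.
Qed.

Section Input.

Variable x : 'I_n -> D.

Definition xstep (v w : T) : Prop :=
  exists2 i : 'I_n, layer v = i & step v (x i) w.

Lemma query_layer (v : lnode) (i : 'I_n) :
  (query (v : node layered_bprog) = Some i) <-> layer (val v) = i.
Proof.
split=> [qv|vi]; have := lnlabel_layer v.
  by rewrite qv /=; case: ltnP => // _ [<-].
by rewrite vi ltn_ord; case: query => //= j [/val_inj->].
Qed.

(** Reduces soundness of a program to an invariant of single steps. *)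
Lemma leads_to_invariant (P : T -> Prop) (t : node layered_bprog) :
  P s -> (forall v w, P v -> xstep v w -> P w) -> leads_to x t ->
  layer (val t) = n /\ P (val t).
Proof.
move=> Ps Pstep [st [p /andP[wp xp]]].
split; first by apply/eqP; rewrite -is_sink_layer.
(* The start is generalized from the source to any node satisfying [P], so that induction on the
   path applies. *)
have: P (val lsource) by [].
move: wp xp; rewrite -[source _]/lsource; move: lsource.
elim: p => [|e p IH] u /=; first by move/eqP->.
move=> /andP[/eqP eu ew] /andP[xe xp] Pu; apply: IH ew xp _.
apply: Pstep Pu _; rewrite -eu; case qe: query xe => [i|//] /eqP ei.
by exists i; [apply/query_layer | rewrite -ei; apply: ledge_step].
Qed.

(** The completeness counterpart. The path grows at its end, since a state becomes a node only once
    its predecessor is known to be reachable. *)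
Lemma leads_to_run (f : nat -> T) :
  f 0 = s -> (forall i : 'I_n, step (f i) (x i) (f i.+1)) ->
  exists2 t, leads_to (B := layered_bprog) x t & val t = f n.
Proof.
move=> f0 fstep.
suff run k : k <= n -> exists (t : lnode) p, [/\ val t = f k,
    layer (f k) = k, walk (source layered_bprog) p t & consistent x p].
  have [t [p [tE nE wp xp]]] := run n (leqnn n).
  exists t => //; split; first by rewrite is_sink_layer tE nE.
  by exists p; rewrite wp xp.
elim: k => [_|k IH lt_kn].
  by exists lsource, [::]; rewrite f0 layer_s /= eqxx.
have [t [p [tE kE wp xp]]] := IH (ltnW lt_kn).
have := fstep (Ordinal lt_kn); rewrite /= -tE => tw.
have [w wE] := lnode_step tw; rewrite -wE in tw.
have [e [et ew] ex] := ledge_exists tw.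
exists w, (rcons p e); split=> //.
- by rewrite -wE (step_layer tw).2 tE kE.
- exact: (walk_rcons wp et ew).
rewrite /consistent all_rcons -/(consistent x p) xp andbT /= et.
have /query_layer-> : layer (val t) = Ordinal lt_kn by rewrite tE kE.
by rewrite ex.
Qed.

End Input.

End LayeredProgram.

(** * Order statistics by counting *)

(** The entries at least [m] form a prefix of a non-increasing list, and position [k] lies in it iff
    its length exceeds [k]. Positivity of [m] excludes the default 0 of [nth]. *)
Lemma count_ge_nth (s : seq nat) m k : sorted geq s -> 0 < m ->
  (k < count (leq m) s) = (m <= nth 0 s k).
Proof.
move=> s_sorted m_gt0; elim: s k s_sorted => [|y s IH] k /=.
  by rewrite nth_nil; case: m m_gt0.
move=> ys; have s_sorted := path_sorted ys.
have [le_my|lt_ym] := leqP m y.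
  by case: k => [|k] /=; rewrite ?le_my // add1n ltnS IH.
have /allP le_y : all (geq y) s.
  by apply: order_path_min ys => a b c /= ba ac; apply: leq_trans ac ba.
rewrite add0n (eq_in_count (a2 := pred0)) => [|z /le_y /= le_zy]; last first.
  by apply/negbTE; rewrite -ltnNge (leq_ltn_trans le_zy).
rewrite count_pred0 ltn0; apply/esym/negbTE; rewrite -ltnNge.
case: k => //= k; have [lt_k|ge_k] := ltnP k (size s).
  by apply: leq_ltn_trans lt_ym; apply: le_y; apply: mem_nth.
by rewrite nth_default.
Qed.

(** The entry is [m] iff it is at least [m] but not at least [m.+1]. [count_ge_nth] turns both
    conditions into counts, and the first count is complemented. *)
Lemma nth_sort_geq (s : seq nat) m k : 0 < m -> k < size s ->
  (nth 0 (sort geq s) k == m) =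
  (count (gtn m) s <= size s - k.+1) && (count (ltn m) s <= k).
Proof.
move=> m_gt0 lt_k.
have geq_total : total geq by move=> a b; apply: leq_total.
have srt := sort_sorted geq_total s.
have := count_ge_nth k srt m_gt0; have := count_ge_nth k srt (ltn0Sn m).
rewrite !(permP (permEl (perm_sort geq s))).
have /= := count_predC (leq m) s.
rewrite (eq_count (a1 := predC (leq m)) (a2 := gtn m)); last first.
  by move=> y /=; lia.
rewrite (eq_count (a1 := leq m.+1) (a2 := ltn m)) //.
lia.
Qed.

Lemma upto_exists N m : 0 < m <= N -> exists d : upto N, upto_nat d = m.
Proof.
case/andP=> m_gt0 le_m; have mP : 0 < (inord m : 'I_N.+1) by rewrite inordK.
by exists (Sub (inord m) mP); rewrite /upto_nat /= inordK.
Qed.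

Lemma upto_bounds N (d : upto N) : 0 < upto_nat d <= N.
Proof. by rewrite (valP d) -ltnS ltn_ord. Qed.

(** * A program for the [k]-th largest input *)

Section Selection.

Variables n k : nat.
Hypothesis k_bounds : 0 < k <= n.

Definition state : finType :=
  ('I_n.+1 * 'I_(2 * n).+1 * 'I_n.+1 * 'I_n.+1)%type.
(* The guess at the source is the junk value 0; [sel_step] ignores it. *)
Definition level (v : state) : nat := v.1.1.1.
Definition guess (v : state) : nat := v.1.1.2.
Definition below (v : state) : nat := v.1.2.
Definition above (v : state) : nat := v.2.

Definition mk_state i m l g : state := (inord i, inord m, inord l, inord g).

(** Inputs are compared with the guess of the target [w], so an edge leaving level 0 chooses the
    guess and already counts the first input. The bounds are tested on the new counts before these
    are reset at level [n]. *)
Definition sel_step (v : state) (d : upto (2 * n)) (w : state) : bool :=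
  let m := guess w in
  let l := below v + (upto_nat d < m) in
  let g := above v + (m < upto_nat d) in
  [&& level w == (level v).+1, 0 < m, (level v == 0) || (guess v == m),
      l <= n - k, g < k,
      below w == (if level w == n then 0 else l) &
      above w == (if level w == n then 0 else g)].

Definition sel_source : state := mk_state 0 0 0 0.

Lemma mk_stateK i m l g : i <= n -> m <= 2 * n -> l <= n -> g <= n ->
  let v := mk_state i m l g in
  [/\ level v = i, guess v = m, below v = l & above v = g].
Proof. by move=> ? ? ? ?; split; apply: inordK. Qed.

Lemma state_inj v w : level v = level w -> guess v = guess w ->
  below v = below w -> above v = above w -> v = w.
Proof.
case: v w => [[[i m] l] g] [[[i' m'] l'] g'].
rewrite /level /guess /below /above.
by move=> /= /val_inj-> /val_inj-> /val_inj-> /val_inj->.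
Qed.

Lemma sel_sourceK : [/\ level sel_source = 0, guess sel_source = 0,
  below sel_source = 0 & above sel_source = 0].
Proof. exact: mk_stateK. Qed.

Lemma sel_layer_source : level sel_source = 0.
Proof. by case: sel_sourceK. Qed.

Lemma sel_step_layer v d w :
  sel_step v d w -> level v < n /\ level w = (level v).+1.
Proof.
by case/and3P=> /eqP lw _ _; rewrite lw -ltnS -lw ltn_ord.
Qed.

Lemma sel_progress v : connect (move sel_step) sel_source v ->
  level v < n -> exists d w, sel_step v d w.
Proof.
move=> sv lt_n; have /andP[k_gt0 le_kn] := k_bounds.
have [m [m_bounds mv lv gv]] : exists m, [/\ 0 < m <= 2 * n,
    (level v == 0) || (guess v == m), below v <= n - k & above v < k].
  case: (connect_last sv) => [->|[u [_ /existsP[d]]]].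
    have [-> _ -> ->] := sel_sourceK.
    (* The guess 0 stored at the source is not a possible input value; 1 is, as [n] is positive. *)
    by exists 1; split=> //; apply/andP; split=> //; lia.
  case/and5P=> _ m_gt0 _ l_le /and3P[g_lt].
  (* As [v] is below level [n], its counts were not reset and are those tested on the edge entering
     it. *)
  rewrite (ltn_eqF lt_n) => /eqP-> /eqP->.
  exists (guess v); split=> //; first by rewrite m_gt0 -ltnS ltn_ord.
  by rewrite eqxx orbT.
have [d dE] := upto_exists m_bounds; exists d.
exists (mk_state (level v).+1 m (if (level v).+1 == n then 0 else below v)
                                (if (level v).+1 == n then 0 else above v)).
have /andP[m_gt0 m_le] := m_bounds.
rewrite /sel_step; set w := mk_state _ _ _ _.
have [-> -> -> ->] : [/\ level w = (level v).+1, guess w = m,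
    below w = (if (level v).+1 == n then 0 else below v) &
    above w = (if (level v).+1 == n then 0 else above v)].
  apply: mk_stateK => //; first by case: ifP => _ //; lia.
  by case: ifP => _ //; lia.
by rewrite dE ltnn !addn0 !eqxx m_gt0 mv lv gv.
Qed.

Definition sel_bprog : bprog n (upto (2 * n)) nat :=
  layered_bprog guess sel_layer_source sel_step_layer sel_progress.

Section Input.

Variable x : 'I_n -> upto (2 * n).

Definition inputs : seq nat := [seq upto_nat (x i) | i : 'I_n].

Lemma size_inputs : size inputs = n.
Proof. by rewrite size_map size_enum_ord. Qed.

Lemma count_take_inputs p (i : 'I_n) :
  count p (take i.+1 inputs) = count p (take i inputs) + p (upto_nat (x i)).
Proof.
rewrite (take_nth 0) ?size_inputs // -cats1 count_cat /= addn0.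
by rewrite (nth_map i) ?size_enum_ord // nth_ord_enum.
Qed.

Lemma sel_leads_to (t : node sel_bprog) : leads_to x t ->
  [/\ level (val t) = n, guess (val t) = nth 0 (sort geq inputs) k.-1,
      below (val t) = 0 & above (val t) = 0].
Proof.
have /andP[k_gt0 le_kn] := k_bounds.
pose lo v := count (gtn (guess v)) (take (level v) inputs).
pose hi v := count (ltn (guess v)) (take (level v) inputs).
(* The last clause bounds the true counts rather than the stored ones, so it survives the reset at
   level [n]. *)
pose P v := [/\ level v < n -> below v = lo v /\ above v = hi v,
  level v = n -> below v = 0 /\ above v = 0 &
  0 < level v -> [/\ 0 < guess v, lo v <= n - k & hi v < k]].
case/(@leads_to_invariant _ _ _ _ _ _ _ _ _ _ _ _ P).
- rewrite /P /lo /hi; have [-> _ -> ->] := sel_sourceK.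
  by rewrite take0; split.
- move=> v w [vlt _ _] [i vi /and5P[/eqP wi w_gt0 vw l_le /and3P[g_lt]]].
  have [|lE gE] := vlt; first by rewrite vi.
  have loE : lo w = below v + (upto_nat (x i) < guess w).
    rewrite /lo wi vi count_take_inputs lE /lo vi.
    (* Either nothing was read before, so that the count is 0 for every guess, or the guess is
       unchanged. *)
    by case/orP: vw => [|/eqP-> //]; rewrite vi => /eqP->; rewrite take0.
  have hiE : hi w = above v + (guess w < upto_nat (x i)).
    rewrite /hi wi vi count_take_inputs gE /hi vi.
    by case/orP: vw => [|/eqP-> //]; rewrite vi => /eqP->; rewrite take0.
  rewrite -loE in l_le *; rewrite -hiE in g_lt *.
  move=> /eqP bw /eqP aw; split=> // [wn|wn].
    by rewrite bw aw (ltn_eqF wn).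
  by rewrite bw aw wn eqxx.
move=> tn [_ /(_ tn)[bt at_] /(_ _)[]]; first by rewrite tn; lia.
rewrite /lo /hi tn -[n in take n]size_inputs take_size => t_gt0 l_le g_lt.
split=> //; apply/esym/eqP; rewrite nth_sort_geq ?size_inputs //; last by lia.
by rewrite prednK // l_le; lia.
Qed.

Lemma sel_leads_to_exists : exists t : node sel_bprog, leads_to x t.
Proof.
have /andP[k_gt0 le_kn] := k_bounds.
set m := nth 0 (sort geq inputs) k.-1.
(* Being an input, [m] is positive and fits the range of guesses. *)
have m_in : m \in inputs.
  rewrite -(mem_sort geq) mem_nth // size_sort size_inputs; lia.
have /andP[m_gt0 m_le] : 0 < m <= 2 * n.
  by have /mapP[i _ ->] := m_in; apply: upto_bounds.
have /esym/andP[lo_le hi_le] : true = (count (gtn m) inputs <= n - k) &&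
    (count (ltn m) inputs <= k.-1).
  have := @nth_sort_geq inputs m k.-1 m_gt0.
  rewrite size_inputs eqxx prednK // => -> //; lia.
have le_take p i : count p (take i inputs) <= count p inputs.
  by rewrite -[in leqRHS](cat_take_drop i inputs) count_cat leq_addr.
pose lo i := count (gtn m) (take i inputs).
pose hi i := count (ltn m) (take i inputs).
(* The accepting run guesses the true answer [m]; the exceptions at [0] and [n] match the junk guess
   of the source and the reset of the counts. *)
pose f i := mk_state i (if i == 0 then 0 else m)
  (if i == n then 0 else lo i) (if i == n then 0 else hi i).
have lo_n i : lo i <= n - k by apply: leq_trans (le_take _ _) lo_le.
have hi_k i : hi i < k.
  by have := leq_trans (le_take _ i) hi_le; rewrite /hi; lia.
have fE i : i <= n -> [/\ level (f i) = i,
    guess (f i) = (if i == 0 then 0 else m),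
    below (f i) = (if i == n then 0 else lo i) &
    above (f i) = (if i == n then 0 else hi i)].
  move=> le_i; apply: mk_stateK => //; first by case: ifP.
    by case: ifP => // _; apply: leq_trans (lo_n i) (leq_subr _ _).
  by case: ifP => // _; apply: leq_trans (ltnW (hi_k i)) le_kn.
have [||t xt _] := @leads_to_run _ _ _ _ _ _ guess _ sel_layer_source
  sel_step_layer sel_progress x f; last by exists t.
- by rewrite /f eqxx /lo /hi take0 !if_same.
move=> i; rewrite /sel_step.
have [-> -> -> ->] := fE i (ltnW (ltn_ord i)).
have [-> -> -> ->] := fE i.+1 (ltn_ord i).
rewrite (ltn_eqF (ltn_ord i)) /=.
have -> : lo i + (upto_nat (x i) < m) = lo i.+1.
  by rewrite /lo count_take_inputs.
have -> : hi i + (m < upto_nat (x i)) = hi i.+1.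
  by rewrite /hi count_take_inputs.
by rewrite !eqxx m_gt0 lo_n hi_k; case: eqP => //=; rewrite eqxx.
Qed.

End Input.

(** Sinks reached by the same input agree in all four components, the counts because of their
    reset. *)
Lemma sel_nondet_bp : nondet_bp sel_bprog.
Proof.
move=> x; have [t xt] := sel_leads_to_exists x; exists t; split=> // t' xt'.
have [? ? ? ?] := sel_leads_to xt; have [? ? ? ?] := sel_leads_to xt'.
by apply: val_inj; apply: state_inj; congruence.
Qed.

Lemma sel_computes : computes sel_bprog
  (fun x => nth 0 (sort geq [seq upto_nat (x i) | i : 'I_n]) k.-1).
Proof.
move=> x t xt; rewrite layered_sink_label; last by case: xt.
by have [_ -> _ _] := sel_leads_to xt.
Qed.

Lemma sel_size : bp_size sel_bprog <= n.+1 ^ 3 * (2 * n).+1.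
Proof.
apply: leq_trans (layered_size _ _ _ _) _.
by rewrite !card_prod !card_ord; lia.
Qed.

End Selection.

Theorem lemma8 :
  exists C : nat, forall n : nat, 0 < n ->
    exists B : bprog n (upto (2 * n)) nat,
      [/\ nondet_bp B, oblivious B, read_once B,
          computes B (fun x : 'I_n -> upto (2 * n) =>
                        median (fun i => upto_nat (x i)))
        & bp_size B <= C * n ^ 4].
Proof.
(* For positive [n], [n.+1 <= 2 * n] and [(2 * n).+1 <= 3 * n], which gives the constant
   [2 ^ 3 * 3]. *)
exists 24 => n n_gt0; have k_bounds : 0 < uphalf n <= n by lia.
exists (sel_bprog k_bounds); split.
- exact: sel_nondet_bp.
- exact: layered_oblivious.
- exact: layered_read_once.
- exact: sel_computes.
apply: leq_trans (sel_size _) _.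
apply: (@leq_trans ((2 * n) ^ 3 * (3 * n))).
  by rewrite leq_mul ?leq_exp2r //; lia.
by rewrite expnMn mulnACA -expnSr.
Qed.
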